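(* Let $p\in[1,\infty]$ and let $y\in\mathcal{Y}_F$ with $\min_{\xi\in\mathbb{Z}}y'_\xi>0$. Put $r^{min}:=2\min_{\xi\in\mathbb{Z}}y'_\xi$ and $\bar C_i:=C_i(r^{min})$ for $i=1,2,3$. (1) Let $\Phi^{qce}_\gamma$ be the BQCE energy with blending function $\gamma$, and set $\alpha_\xi:=\frac{\gamma_\xi+\gamma_{\xi-1}}{2}$ and $\beta_\xi:=1-\frac{\gamma_{\xi+1}+\gamma_{\xi-1}}{2}$. Then $$\|\delta\Phi(y)-\delta\Phi^{qce}_\gamma(y)\|_{\mathcal{U}^{-1,p}}\le \bar C_1\|\Delta^2\alpha_\xi\|_{\ell^p_\varepsilon}+\varepsilon\bar C_2\|\Delta\beta_\xi\,y''_\xi\|_{\ell^p_\varepsilon}+\varepsilon^2\left\{\bar C_2\|(1-\beta_{\xi-1})y'''_\xi\|_{\ell^p_\varepsilon}+\bar C_3\|(1-\beta_\xi)(y''_\xi)^2\|_{\ell^p_\varepsilon}\right\}.$$ (2) Let $\Phi^{qnl}_\beta$ be the BQNL energy with blending function $\beta$. Then $$\|\delta\Phi(y)-\delta\Phi^{qnl}_\beta(y)\|_{\mathcal{U}^{-1,p}}\le \varepsilon\bar C_2\|\Delta\beta_\xi\,y''_\xi\|_{\ell^p_\varepsilon}+\varepsilon^2\left\{\bar C_2\|(1-\beta_{\xi-1})y'''_\xi\|_{\ell^p_\varepsilon}+\bar C_3\|(1-\beta_\xi)(y''_\xi)^2\|_{\ell^p_\varepsilon}\right\}.$$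
   Context: Fix $N\in\mathbb{N}$, $\varepsilon=1/N$ and $F\in(0,\infty)$. Let $\mathcal{U}$ be the space of $u:\mathbb{Z}\to\mathbb{R}$ with $u_{\xi+N}=u_\xi$ for all $\xi$ and $\sum_{\xi=1}^N u_\xi=0$, and let $\mathcal{Y}_F$ be the set of $y:\mathbb{Z}\to\mathbb{R}$ of the form $y_\xi=F\varepsilon\xi+u_\xi$ with $u\in\mathcal{U}$. Differences: $\Delta v_\xi=v_\xi-v_{\xi-1}$, $\Delta^2v_\xi=v_{\xi+1}-2v_\xi+v_{\xi-1}$, $v'_\xi=\frac{v_\xi-v_{\xi-1}}{\varepsilon}$, $v''_\xi=\frac{v_{\xi+1}-2v_\xi+v_{\xi-1}}{\varepsilon^2}$, $v'''_\xi=\frac{v_{\xi+1}-3v_\xi+3v_{\xi-1}-v_{\xi-2}}{\varepsilon^3}$. In a product such as $\Delta\beta_\xi\,y''_\xi$, $\Delta$ acts only on $\beta$. Potential: $\phi\in C^4((0,\infty],\mathbb{R})$; there is $r^*>0$ with $\phi''(r)>0$ for $r\in(0,r^* )$ and $\phi''(r)<0$ for $r\in(r^*,\infty)$; $\phi$ and its derivatives decay at infinity. $C_i(r_0):=\sup_{r\ge r_0}|\phi^{(i)}(r)|$ for $i=1,\dots,4$. Energies (for $y\in\mathcal{Y}_F$ with $y'_\xi>0$ for all $\xi$). Atomistic energy: $$\Phi(y)=\varepsilon\sum_{\xi=1}^N\{\phi(y'_\xi)+\phi(y'_\xi+y'_{\xi+1})\}.$$ BQCE energy with $N$-periodic blending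 function $\gamma:\mathbb{Z}\to[0,1]$: $$\Phi^{qce}_\gamma(y)=\varepsilon\sum_{\xi=1}^N\Big\{\phi(y'_\xi)+\tfrac{\gamma_\xi}{2}\{\phi(2y'_\xi)+\phi(2y'_{\xi+1})\}+\tfrac{1-\gamma_\xi}{2}\{\phi(y'_{\xi-1}+y'_\xi)+\phi(y'_{\xi+1}+y'_{\xi+2})\}\Big\}.$$ BQNL energy with $N$-periodic blending function $\beta:\mathbb{Z}\to[0,1]$: $$\Phi^{qnl}_\beta(y)=\varepsilon\sum_{\xi=1}^N\Big\{\phi(y'_\xi)+\beta_\xi\phi(y'_\xi+y'_{\xi+1})+\tfrac{1-\beta_\xi}{2}\{\phi(2y'_\xi)+\phi(2y'_{\xi+1})\}\Big\}.$$ $\delta\Psi(y)[u]$ denotes the first variation of $\Psi$ at $y$ in the direction $u\in\mathcal{U}$; $\delta\Psi(y)$ is a linear functional on $\mathcal{U}$. Norms of $N$-periodic functions: $\|v\|_{\ell^p_\varepsilon}=(\varepsilon\sum_{\xi=1}^N|v_\xi|^p)^{1/p}$ for $p<\infty$, and for $p=\infty$, $\|v\|_{\ell^\infty_\varepsilon}=\|v\|_{\ell^\infty}=\max_{1\le\xi\le N}|v_\xi|$. $\mathcal{U}^{1,q}$ is $\mathcal{U}$ with norm $\|u\|_{\mathcal{U}^{1,q}}=\|u'\|_{\ell^q_\varepsilon}$, and $\mathcal{U}^{-1,p}=(\mathcal{U}^{1,q})^*$ with the dual norm, where $\frac1p+\frac1q=1$. *)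

(* Defs.v *)
From HB Require Import structures.
From mathcomp Require Import all_boot all_order all_algebra.
From mathcomp Require Import all_classical all_reals all_analysis.

Set Implicit Arguments.
Unset Strict Implicit.
Unset Printing Implicit Defensive.

Import Order.TTheory GRing.Theory Num.Theory.
Import numFieldNormedType.Exports.

Local Open Scope classical_set_scope.
Local Open Scope ring_scope.

(* Lattice functions are maps [int -> R]; the lattice has period N and spacing
   [eps R N]. *)

Definition eps (R : realType) (N : nat) : R := N%:R^-1.

Definition periodic (R : realType) (N : nat) (v : int -> R) : Prop :=
  forall xi : int, v (xi + N%:Z) = v xi.

Definition sum_period (R : realType) (N : nat) (v : int -> R) : R :=
  \sum_(1 <= k < N.+1) v k%:Z.

Definition displacements (R : realType) (N : nat) : set (int -> R) :=
  [set u | periodic N u /\ sum_period N u = 0].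

Definition deformations (R : realType) (N : nat) (F : R) : set (int -> R) :=
  [set y | exists2 u, displacements N u &
           forall xi : int, y xi = F * eps R N * xi%:~R + u xi].

Definition blending (R : realType) (N : nat) (b : int -> R) : Prop :=
  periodic N b /\ forall xi : int, 0 <= b xi <= 1.

Definition Delta (R : realType) (v : int -> R) (xi : int) : R :=
  v xi - v (xi - 1).

Definition Delta2 (R : realType) (v : int -> R) (xi : int) : R :=
  v (xi + 1) - 2 * v xi + v (xi - 1).

Definition D1 (R : realType) (N : nat) (v : int -> R) (xi : int) : R :=
  (v xi - v (xi - 1)) / eps R N.

Definition D2 (R : realType) (N : nat) (v : int -> R) (xi : int) : R :=
  (v (xi + 1) - 2 * v xi + v (xi - 1)) / eps R N ^+ 2.

Definition D3 (R : realType) (N : nat) (v : int -> R) (xi : int) : R :=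
  (v (xi + 1) - 3 * v xi + 3 * v (xi - 1) - v (xi - 2)) / eps R N ^+ 3.

(* The infimum is attained when v is periodic with N > 0, as it is for
   v = D1 N y with y a deformation. *)
Definition min_lattice (R : realType) (v : int -> R) : R := inf (range v).

(* The potential is a total function, but only its restriction to ]0, +oo[ is
   constrained; derivatives at r > 0 do not depend on the values at r <= 0. *)
Definition C_pos (R : realType) (n : nat) (f : R -> R) : Prop :=
  (forall k r, (k < n)%N -> 0 < r -> derivable (derive1n k f) r 1) /\
  (forall r, 0 < r -> {for r, continuous (derive1n n f)}).

(* Regularity up to r = +oo is the decay condition, with the value 0 there. *)
Definition potential (R : realType) (phi : R -> R) : Prop :=
  [/\ C_pos 4 phi,
      exists2 rstar : R, 0 < rstar &
        (forall r, 0 < r -> r < rstar -> 0 < derive1n 2 phi r) /\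
        (forall r, rstar < r -> derive1n 2 phi r < 0) &
      forall k, (k <= 4)%N -> derive1n k phi r @[r --> +oo] --> (0 : R)].

Definition Csup (R : realType) (phi : R -> R) (i : nat) (r0 : R) : R :=
  sup [set `|derive1n i phi r| | r in [set r | r0 <= r]].

Definition Phi_at (R : realType) (N : nat) (phi : R -> R) (y : int -> R) : R :=
  eps R N * sum_period N (fun xi =>
    phi (D1 N y xi) + phi (D1 N y xi + D1 N y (xi + 1))).

Definition Phi_qce (R : realType) (N : nat) (phi : R -> R) (gamma : int -> R)
    (y : int -> R) : R :=
  eps R N * sum_period N (fun xi =>
    phi (D1 N y xi)
    + gamma xi / 2 * (phi (2 * D1 N y xi) + phi (2 * D1 N y (xi + 1)))
    + (1 - gamma xi) / 2 * (phi (D1 N y (xi - 1) + D1 N y xi)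
                            + phi (D1 N y (xi + 1) + D1 N y (xi + 2)))).

Definition Phi_qnl (R : realType) (N : nat) (phi : R -> R) (beta : int -> R)
    (y : int -> R) : R :=
  eps R N * sum_period N (fun xi =>
    phi (D1 N y xi)
    + beta xi * phi (D1 N y xi + D1 N y (xi + 1))
    + (1 - beta xi) / 2 * (phi (2 * D1 N y xi) + phi (2 * D1 N y (xi + 1)))).

Definition first_variation (R : realType) (Psi : (int -> R) -> R)
    (y u : int -> R) : R :=
  derive1 (fun t : R => Psi (fun xi => y xi + t * u xi)) 0.

(* The value at p = -oo is a dummy. *)
Definition lnorm (R : realType) (N : nat) (p : \bar R) (v : int -> R) : R :=
  match p with
  | EFin s => (eps R N * sum_period N (fun xi => `|v xi| `^ s)) `^ s^-1
  | +oo%E => \big[Num.max/0]_(1 <= k < N.+1) `|v k%:Z|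
  | -oo%E => 0
  end.

Definition norm_U1 (R : realType) (N : nat) (q : \bar R) (u : int -> R) : R :=
  lnorm N q (D1 N u).

(* Dual norm of norm_U1 at the Hoelder conjugate of p. It is extended-real
   valued, so that a finite upper bound asserts boundedness. *)
Definition norm_Um1 (R : realType) (N : nat) (p : \bar R)
    (l : (int -> R) -> R) : \bar R :=
  ereal_sup [set (`|l u|)%:E | u in
    [set u | displacements N u /\ norm_U1 N (hoelder_conjugate p) u <= 1]].

(* Main.v *)
Require Import Defs.
From HB Require Import structures.
From mathcomp Require Import all_boot all_order all_algebra.
From mathcomp Require Import all_classical all_reals all_analysis.
From mathcomp Require Import ring lra.

Set Implicit Arguments.
Unset Strict Implicit.
Unset Printing Implicit Defensive.

Import Order.TTheory GRing.Theory Num.Theory.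
Import numFieldNormedType.Exports.

Local Open Scope classical_set_scope.
Local Open Scope ring_scope.

(** Write s = y' and v = u' for the slopes of the deformation and of the test
function, f = phi', and r = r^min.  Summing by parts over a period, the
difference of the atomistic and the BQNL first variations becomes
eps * sum_xi S_xi v_xi, where S ([stress_defect]) is
<<
  S_xi = (1 - beta_xi)     (f (s_xi + s_{xi+1}) - f (2 s_xi))
       + (1 - beta_{xi-1}) (f (s_{xi-1} + s_xi) - f (2 s_xi)).
>>
For the BQCE energy the same summation, with beta_xi the weight which the pair
bond (xi, xi+1) receives from the two neighbouring sites, gives S plus the
ghost force Delta^2 alpha_xi f (2 s_xi) ([qnl_error_functional],
[qce_error_functional]).

The bound on S is pointwise ([stress_defect_bound]).  With x = 2 s_xi,
a = s_{xi+1} - s_xi = eps y''_xi and b = s_xi - s_{xi-1} = eps y''_{xi-1},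
<<
  S_xi = - Delta beta_xi (f (x + a) - f x)
         + (1 - beta_{xi-1}) (f (x + a) + f (x - b) - 2 f x).
>>
The first term is at most C2 |Delta beta_xi| |a|.  The bracket in the second is
at most C2 |a - b| + C3 b^2 ([asymmetric_second_difference_bound]), and
a - b = eps^2 y'''_xi.  The delicate point is that phi is controlled on [r, oo[
only: x, x + a and x - b lie there, but x - a and x + b need not, so one cannot
simply compare with the second difference of step |a| or of step |b|.  If a and
b have opposite signs, then |a - b| = |a| + |b| and two first differences
suffice; if they have the same sign, the symmetric second difference of the
smaller of the two steps stays inside the interval spanned by x + a and x - b.

The bounds pass to the dual norm by applying Hoelder's inequality to each piece
separately ([norm_Um1_le]).  The C3 piece comes out evaluated at xi - 1, which
is harmless because the norms are invariant under shifts ([lnorm_shift]). *)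

(** * Sums over one period *)

(** Summation by parts without boundary terms: all reindexings of a periodic
sum are packed into one flux h, so that they reduce to a pointwise identity. *)
Lemma sum_period_telescope (R : realType) (N : nat) (f g h : int -> R) :
  Defs.periodic N h -> (forall xi, f xi = g xi + (h (xi + 1) - h xi)) ->
  sum_period N f = sum_period N g.
Proof.
move=> hper fg; rewrite /sum_period.
under eq_bigr do rewrite fg.
rewrite big_split /= [X in _ + X](_ : _ = 0) ?addr0//.
under eq_bigr do rewrite -PoszD addn1.
rewrite (telescope_sumr (fun k : nat => h k%:Z)) //.
by rewrite -add1n PoszD hper subrr.
Qed.

Lemma sum_periodB (R : realType) (N : nat) (f g : int -> R) :
  sum_period N (fun xi => f xi - g xi) = sum_period N f - sum_period N g.
Proof. exact: sumrB. Qed.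

Lemma sum_period_shift (R : realType) (N : nat) (f : int -> R) :
  Defs.periodic N f -> sum_period N (fun xi => f (xi - 1)) = sum_period N f.
Proof.
move=> fper; apply/esym/(sum_period_telescope (h := fun xi => f (xi - 1))).
  by move=> xi; rewrite -addrA [N%:Z - 1]addrC addrA fper.
by move=> xi; rewrite addrK addrC subrK.
Qed.

(** * Discrete norms *)

(** The weight w stays inside both roots, as eps does in the discrete norms;
this costs nothing because p^-1 + q^-1 = 1. The proof is the usual one, Young's
inequality for the normalized sequences. *)
Lemma weighted_hoelder (R : realType) (I : eqType) (s : seq I) (w : R)
    (a b : I -> R) (p q : R) :
  0 <= w -> 0 < p -> 0 < q -> p^-1 + q^-1 = 1 ->
  (forall i, 0 <= a i) -> (forall i, 0 <= b i) ->
  w * \sum_(i <- s) a i * b i <=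
    (w * \sum_(i <- s) a i `^ p) `^ p^-1 * (w * \sum_(i <- s) b i `^ q) `^ q^-1.
Proof.
move=> w0 p0 q0 pq a0 b0.
have root_eq0 (t : R) (c d : I -> R) : (forall i, 0 <= c i) -> 0 < t ->
    (w * \sum_(i <- s) c i `^ t) `^ t^-1 = 0 -> w * \sum_(i <- s) c i * d i = 0.
  move=> c0 t0 /powR_eq0_eq0 /eqP.
  rewrite mulf_eq0 => /orP[/eqP->|]; first by rewrite mul0r.
  rewrite psumr_eq0 => [/allP /= sc|i _]; last exact: powR_ge0.
  rewrite big1_seq ?mulr0// => i /andP[_ /sc /eqP /powR_eq0_eq0 ->].
  by rewrite mul0r.
have [A0|A_neq0] := eqVneq ((w * \sum_(i <- s) a i `^ p) `^ p^-1) 0.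
  by rewrite (root_eq0 _ _ _ a0 p0 A0) A0 mul0r.
have [B0|B_neq0] := eqVneq ((w * \sum_(i <- s) b i `^ q) `^ q^-1) 0.
  under eq_bigr do rewrite mulrC.
  by rewrite (root_eq0 _ _ _ b0 q0 B0) B0 mulr0.
set A := (_ `^ p^-1) in A_neq0 *; set B := (_ `^ q^-1) in B_neq0 *.
have A_gt0 : 0 < A by rewrite lt0r A_neq0 powR_ge0.
have B_gt0 : 0 < B by rewrite lt0r B_neq0 powR_ge0.
have rootK (t : R) (c : I -> R) : (forall i, 0 <= c i) -> 0 < t ->
    ((w * \sum_(i <- s) c i `^ t) `^ t^-1) `^ t = w * \sum_(i <- s) c i `^ t.
  move=> c0 t0; rewrite -powRrM mulVf ?gt_eqF// powRr1//.
  by rewrite mulr_ge0// sumr_ge0// => i _; exact: powR_ge0.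
have Ap := rootK p a a0 p0; have Bq := rootK q b b0 q0.
rewrite -/A in Ap; rewrite -/B in Bq.
(* From here on A and B only matter through A ^ p and B ^ q; hiding the roots
   they stand for keeps unification from unfolding them. *)
move: A B A_neq0 B_neq0 A_gt0 B_gt0 Ap Bq {root_eq0 rootK} => A B _ _ A_gt0 B_gt0 Ap Bq.
rewrite -[A * B]mul1r -ler_pdivrMr ?mulr_gt0//.
have powRV (t c : R) : 0 < c -> c^-1 `^ t = (c `^ t)^-1.
  by move=> /ltW c0; rewrite -powR_inv1// -powRrM mulN1r powRN.
suff: w * \sum_(i <- s) (a i / A) * (b i / B) <= p^-1 + q^-1.
  rewrite pq => h; apply: le_trans _ h; rewrite -mulrA ler_wpM2l// mulr_suml.
  by apply: ler_sum => i _; rewrite mulf_div.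
apply: (@le_trans _ _ (w * \sum_(i <- s) (a i `^ p / A `^ p / p + b i `^ q / B `^ q / q))).
  rewrite ler_wpM2l// ler_sum// => i _.
  have aA0 : 0 <= a i / A by rewrite divr_ge0// ltW.
  have bB0 : 0 <= b i / B by rewrite divr_ge0// ltW.
  apply: le_trans (conjugate_powR aA0 bB0 p0 q0 pq) _.
  by rewrite !powRM ?invr_ge0 ?(ltW A_gt0) ?(ltW B_gt0)// !powRV.
rewrite big_split -!mulr_suml mulrDr !mulrA -Ap -Bq.
by rewrite !divff ?gt_eqF ?powR_gt0// !mul1r.
Qed.

Lemma lnorm_ge0 (R : realType) (N : nat) (p : \bar R) (v : int -> R) :
  0 <= lnorm N p v.
Proof.
case: p => [s| |] /=; rewrite ?powR_ge0//.
exact: bigmax_ge_id.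
Qed.

Lemma norm_le_lnormy (R : realType) (N k : nat) (v : int -> R) :
  (1 <= k < N.+1)%N -> `|v k%:Z| <= lnorm N +oo%E v.
Proof.
move=> kN; apply: (@le_bigmax_seq _ _ _ _ _ k xpredT (fun j : nat => `|v j%:Z|)) => //.
by rewrite mem_index_iota.
Qed.

Lemma lnorm_hoelder_1_infty (R : realType) (N : nat) (v w : int -> R) :
  eps R N * sum_period N (fun xi => `|v xi| * `|w xi|)
    <= lnorm N 1%E v * lnorm N +oo%E w.
Proof.
have e0 : 0 <= eps R N by rewrite invr_ge0.
rewrite [lnorm N 1%E v]/= invr1 powRr1; last first.
  by rewrite mulr_ge0// sumr_ge0// => i _; exact: powR_ge0.
rewrite -mulrA ler_wpM2l// mulr_suml; apply: ler_sum_nat => k kN.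
by rewrite powRr1// ler_wpM2l// norm_le_lnormy.
Qed.

Lemma lnorm_hoelder (R : realType) (N : nat) (p : \bar R) (v w : int -> R) :
  (1 <= p)%E ->
  eps R N * sum_period N (fun xi => `|v xi| * `|w xi|)
    <= lnorm N p v * lnorm N (hoelder_conjugate p) w.
Proof.
move=> p1; have e0 : 0 <= eps R N by rewrite invr_ge0.
have swap : sum_period N (fun xi => `|v xi| * `|w xi|)
          = sum_period N (fun xi => `|w xi| * `|v xi|).
  by apply: eq_bigr => k _; rewrite mulrC.
have [->|py] := eqVneq p +oo%E.
  by rewrite hoelder_conjugatey swap [leRHS]mulrC lnorm_hoelder_1_infty.
have [->|p_neq1] := eqVneq p 1%E.
  by rewrite hoelder_conjugate1 lnorm_hoelder_1_infty.
have q1 := hoelder_conj_ge1 p1.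
have pq : (p^-1 + (hoelder_conjugate p)^-1 = 1)%E.
  apply: hoelder_conjugate_eq1; first by rewrite (lt_le_trans _ p1)// ltNyr.
  by rewrite gt_eqF// (lt_le_trans _ p1).
have : hoelder_conjugate p != +oo%E.
  by apply: contraNN p_neq1 => /eqP /hoelder_conjugate_eqy ->.
case: (hoelder_conjugate p) q1 pq => [q| |]// q1 + _.
case: p p1 py {p_neq1} => [p| |]// p1 _.
rewrite !lee_fin in p1 q1.
have p0 : 0 < p by rewrite (lt_le_trans _ p1).
have q0 : 0 < q by rewrite (lt_le_trans _ q1).
rewrite !inver !gt_eqF// -EFinD => -[pq].
exact: weighted_hoelder.
Qed.

Lemma lnorm_shift (R : realType) (N : nat) (hN : (0 < N)%N) (p : \bar R)
    (v : int -> R) :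
  Defs.periodic N v -> lnorm N p (fun xi => v (xi - 1)) <= lnorm N p v.
Proof.
move=> vper; case: p => [s| |]; last exact: lexx.
  rewrite /= (sum_period_shift (f := fun xi => `|v xi| `^ s))// => xi.
  by rewrite vper.
rewrite [leLHS]/= big_nat; apply: bigmax_le => [|k]; first exact: bigmax_ge_id.
case: k => // -[_|k kN].
  (* the entry at 0 wraps around to the entry at N *)
  by rewrite subrr -(vper 0) add0r (@norm_le_lnormy _ N N) ?hN /=.
rewrite (_ : k.+2%:Z - 1 = k.+1%:Z) ?(@norm_le_lnormy _ N k.+1) ?(ltnW kN)//.
Qed.

(** * Difference estimates on a half-line *)

Lemma lipschitz_of_derive_bound (R : realType) (f f' : R -> R) (r0 M : R) :
  (forall r, r0 <= r -> is_derive r 1 f (f' r)) ->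
  (forall r, r0 <= r -> `|f' r| <= M) ->
  forall a b, r0 <= a -> r0 <= b -> `|f b - f a| <= M * `|b - a|.
Proof.
move=> df f'M a b; wlog ab : a b / a <= b => [H ra rb|ra rb].
  by have [/H->//|/ltW/H] := leP a b; rewrite distrC [X in M * X]distrC; apply.
have cf : {within `[a, b], continuous f}.
  apply: derivable_within_continuous => x /itvP xab.
  have rx : r0 <= x by rewrite (le_trans ra)// xab.
  by have [] := df x rx.
have dfab x : x \in `]a, b[ -> is_derive x 1 f (f' x).
  by move=> /itvP xab; apply: df; rewrite (le_trans ra)// xab.
have [c /itvP cab ->] := MVT_segment ab dfab cf.
by rewrite normrM ler_wpM2r// f'M// (le_trans ra)// cab.
Qed.

(** The mean value theorem applied directly to t |-> f (x + t) + f (x - t) would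
lose a factor 2, since the derivative at t is only bounded by 2 M t. Subtracting
M t^2 first makes the function of t nonincreasing and gives the sharp
constant. *)
Lemma second_difference_bound (R : realType) (f f' f'' : R -> R) (r0 M : R) :
  (forall r, r0 <= r -> is_derive r 1 f (f' r)) ->
  (forall r, r0 <= r -> is_derive r 1 f' (f'' r)) ->
  (forall r, r0 <= r -> `|f'' r| <= M) ->
  forall x h, 0 <= h -> r0 <= x - h ->
    `|f (x + h) + f (x - h) - 2 * f x| <= M * h ^+ 2.
Proof.
move=> df df' f''M x h h0 rxh.
(* Both signs of the second difference are treated at once, as s = 1 and
   s = -1. *)
suff one_sided s : `|s| <= 1 ->
    s * (f (x + h) + f (x - h) - 2 * f x) <= M * h ^+ 2.
  rewrite ler_norml -lerNl -mulN1r -[X in _ && (X <= _)]mul1r.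
  by rewrite !one_sided// ?normrN normr1.
move=> s1.
pose g t := s * (f (x + t) + f (x - t)) - M * t ^+ 2.
pose dg t := s * (f' (x + t) - f' (x - t)) - M * (2 * t).
have Dg t : 0 <= t -> t <= h -> is_derive t 1 g (dg t).
  move=> t0 th; have hp := df (x + t) ltac:(lra); have hm := df (x - t) ltac:(lra).
  have Dp : is_derive t 1 (fun t => x + t) 1.
    by have := is_deriveD (is_derive_cst x t 1) (is_derive_id t 1); rewrite add0r.
  have Dm : is_derive t 1 (fun t => x - t) (-1).
    by have := is_deriveB (is_derive_cst x t 1) (is_derive_id t 1); rewrite sub0r.
  have Fp := is_derive1_comp (g := fun t => x + t) hp Dp.
  have Fm := is_derive1_comp (g := fun t => x - t) hm Dm.
  have Dt := is_deriveB (is_deriveZ s (is_deriveD Fp Fm))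
                     (is_deriveZ M (is_deriveX 2 (is_derive_id t 1))).
  apply: (is_derive_eq Dt).
  by rewrite /dg /GRing.scale /=; ring.
have cg : {within `[0, h], continuous g}.
  apply: derivable_within_continuous => t /itvP th.
  have t0 : 0 <= t by rewrite th.
  have t_le : t <= h by rewrite th.
  by have [] := Dg t t0 t_le.
have Dg' t : t \in `]0, h[ -> is_derive t 1 g (dg t).
  by move=> /itvP th; apply: Dg; rewrite th.
have [c /itvP ch] := MVT_segment h0 Dg' cg.
have c0 : 0 <= c by rewrite ch.
have cleh : c <= h by rewrite ch.
rewrite /g subr0 addr0 => geq.
suff : dg c * h <= 0 by lra.
apply: mulr_le0_ge0 => //; rewrite subr_le0.
have := lipschitz_of_derive_bound df' f''M (a := x - c) (b := x + c).
move=> /(_ ltac:(lra) ltac:(lra)).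
have -> : x + c - (x - c) = 2 * c by ring.
rewrite (ger0_norm (_ : 0 <= 2 * c)) ?mulr_ge0//; apply: le_trans.
by rewrite (le_trans (ler_norm _))// normrM ler_piMl.
Qed.

(** Only x, x + a and x - b are assumed to lie in the half-line where f is
controlled, which excludes a comparison with f (x + b) or f (x - a) in general.
For a and b of the same sign, let h be the smaller of |a| and |b|: x - h and
x + h both lie between x + a and x - b, the symmetric second difference of step
h costs M2 h^2 <= M2 b^2, and what remains is one first difference of length
|a - b|. For opposite signs |a - b| = |a| + |b|, so M2 does not enter. *)
Lemma asymmetric_second_difference_bound (R : realType) (f f' f'' : R -> R)
    (r0 M1 M2 : R) :
  (forall r, r0 <= r -> is_derive r 1 f (f' r)) ->
  (forall r, r0 <= r -> is_derive r 1 f' (f'' r)) ->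
  (forall r, r0 <= r -> `|f' r| <= M1) ->
  (forall r, r0 <= r -> `|f'' r| <= M2) ->
  forall x a b, r0 <= x -> r0 <= x + a -> r0 <= x - b ->
    `|f (x + a) + f (x - b) - 2 * f x| <= M1 * `|a - b| + M2 * b ^+ 2.
Proof.
move=> df df' f'M f''M x a b rx ra rb.
have lip := lipschitz_of_derive_bound df f'M.
have M2_ge0 : 0 <= M2 by apply: le_trans (f''M _ rx).
have b2_ge0 : 0 <= M2 * b ^+ 2 by rewrite mulr_ge0// sqr_ge0.
(* The case a, b of the same sign: z and w are the two points left over by the
   symmetric second difference of step h. *)
have split_at h z w : f (x + a) + f (x - b) = f (x + h) + f (x - h) + (f z - f w) ->
    0 <= h -> h ^+ 2 <= b ^+ 2 -> r0 <= x - h -> r0 <= z -> r0 <= w ->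
    `|z - w| = `|a - b| ->
    `|f (x + a) + f (x - b) - 2 * f x| <= M1 * `|a - b| + M2 * b ^+ 2.
  move=> -> h0 hb rh rz rw <-.
  have -> : f (x + h) + f (x - h) + (f z - f w) - 2 * f x
          = (f z - f w) + (f (x + h) + f (x - h) - 2 * f x) by ring.
  rewrite (le_trans (ler_normD _ _))// lerD ?lip//.
  by rewrite (le_trans (second_difference_bound df df' f''M h0 rh))// ler_wpM2l.
have [a0|/ltW a0] := leP 0 a; have [b0|/ltW b0] := leP 0 b.
- have [ab|/ltW ab] := leP a b.
  + apply: (split_at a (x - b) (x - a)) => //; [ring|nra|lra|lra|].
    by congr `|_|; ring.
  + apply: (split_at b (x + a) (x + b)) => //; [ring|lra|].
    by congr `|_|; ring.
- have -> : f (x + a) + f (x - b) - 2 * f x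
          = (f (x + a) - f x) + (f (x - b) - f x) by ring.
  rewrite (le_trans (ler_normD _ _))//.
  have := lip _ _ rx ra; have := lip _ _ rx rb.
  have -> : x + a - x = a by ring.
  have -> : x - b - x = - b by ring.
  rewrite (ger0_norm a0) normrN (ler0_norm b0) (ger0_norm (_ : 0 <= a - b)); lra.
- have -> : f (x + a) + f (x - b) - 2 * f x
          = (f (x + a) - f x) + (f (x - b) - f x) by ring.
  rewrite (le_trans (ler_normD _ _))//.
  have := lip _ _ rx ra; have := lip _ _ rx rb.
  have -> : x + a - x = a by ring.
  have -> : x - b - x = - b by ring.
  rewrite (ler0_norm a0) normrN (ger0_norm b0) (ler0_norm (_ : a - b <= 0)); lra.
- have [ab|/ltW ab] := leP a b.
  + apply: (split_at (- b) (x + a) (x + b)) => //; rewrite ?opprK; [ring|lra|by rewrite sqrrN|lra|lra|].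
    by congr `|_|; ring.
  + apply: (split_at (- a) (x - b) (x - a)) => //; rewrite ?opprK; [ring|lra|nra|lra|lra|].
    by congr `|_|; ring.
Qed.

(** * The potential *)

Lemma potential_is_derive (R : realType) (phi : R -> R) (k : nat) (r : R) :
  potential phi -> (k < 4)%N -> 0 < r ->
  is_derive r 1 (derive1n k phi) (derive1n k.+1 phi r).
Proof.
move=> hphi k4 r0; have [[dphi _] _ _] := hphi.
by rewrite derive1nS derive1E; apply/derivableP/dphi.
Qed.

(** The supremum is a genuine upper bound only if the set is bounded: near
infinity this is the decay of the derivatives, and on the remaining compact
interval the extreme value theorem. *)
Lemma le_Csup (R : realType) (phi : R -> R) (i : nat) (r0 r : R) :
  potential phi -> (i < 4)%N -> 0 < r0 -> r0 <= r -> `|derive1n i phi r| <= Csup phi i r0.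
Proof.
move=> hphi i4 r0_gt0 r0r; have [_ _ decay] := hphi.
rewrite /Csup; apply: ub_le_sup; last by exists r.
have [M [_ Mdecay]] : \forall r \near +oo, `|derive1n i phi r| <= 1.
  have := decay i (ltnW i4) => /cvgr0_norm_le; apply; exact: ltr01.
pose b := Num.max r0 (M + 1).
have r0b : r0 <= b by rewrite le_max lexx.
have cphi : {within `[r0, b], continuous (fun x => `|derive1n i phi x|)}.
  apply: within_continuous_comp => [z _|]; first exact: norm_continuous.
  apply: derivable_within_continuous => x /itvP xab.
  have x0 : 0 < x by rewrite (lt_le_trans r0_gt0)// xab.
  by have [] := potential_is_derive hphi i4 x0.
have [c cb cmax] := EVT_max r0b cphi.
exists (Num.max `|derive1n i phi c| 1) => _ [x /= r0x <-].
rewrite le_max; have [xb|bx] := leP x b.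
  by rewrite cmax// in_itv /= r0x.
rewrite Mdecay ?orbT//.
by apply: lt_trans bx; rewrite lt_max ltrDl ltr01 orbT.
Qed.

(** * First variations *)

Lemma is_derive_along_line (R : realType) (phi : R -> R) (l : R -> R) (c v : R) :
  potential phi -> 0 < c -> (forall t, l t = c + t * v) ->
  is_derive (0 : R) 1 (fun t => phi (l t)) (derive1n 1 phi c * v).
Proof.
move=> hphi c0 lE.
have -> : l = (fun t => c + t * v) by apply/funext.
have dl : is_derive (0 : R) 1 (fun t : R => c + t * v) v.
  have D := is_deriveD (is_derive_cst c (0 : R) 1)
                       (is_deriveM (is_derive_id (0 : R) 1) (is_derive_cst v (0 : R) (1 : R))).
  by apply: (is_derive_eq D); rewrite /GRing.scale /=; ring.
apply: (@is_derive1_comp _ phi (fun t => c + t * v) 0 _ _ _ dl).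
by rewrite mul0r addr0; apply: (@potential_is_derive _ phi 0).
Qed.

Lemma first_variation_sum_period (R : realType) (N : nat)
    (G : (int -> R) -> int -> R) (dG : int -> R) (y u : int -> R) :
  (forall xi, is_derive (0 : R) 1 (fun t => G (fun z => y z + t * u z) xi) (dG xi)) ->
  first_variation (fun y => eps R N * sum_period N (G y)) y u
    = eps R N * sum_period N dG.
Proof.
move=> DG; rewrite /first_variation /sum_period derive1E.
have Dsum (s : seq nat) : is_derive (0 : R) 1
    (fun t => \sum_(k <- s) G (fun z => y z + t * u z) k%:Z)
    (\sum_(k <- s) dG k%:Z).
  elim: s => [|k s IH].
    rewrite big_nil.
    have -> : (fun t => \sum_(k <- [::]) G (fun z => y z + t * u z) k%:Z) = cst 0.
      by apply/funext => t; rewrite big_nil.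
    exact: is_derive_cst.
  rewrite big_cons.
  have -> : (fun t => \sum_(j <- k :: s) G (fun z => y z + t * u z) j%:Z)
          = (fun t => G (fun z => y z + t * u z) k%:Z)
            + (fun t => \sum_(j <- s) G (fun z => y z + t * u z) j%:Z).
    by apply/funext => t; rewrite big_cons.
  exact: is_deriveD.
have D : is_derive (0 : R) 1 (fun t : R => eps R N *
    \sum_(1 <= k < N.+1) G (fun z => y z + t * u z) k%:Z) _ :=
  is_deriveZ (eps R N) (Dsum (index_iota 1 N.+1)).
by rewrite (@derive_val _ _ _ _ _ _ _ D).
Qed.

Lemma D1_line (R : realType) (N : nat) (y u : int -> R) (t : R) (xi : int) :
  D1 N (fun z => y z + t * u z) xi = D1 N y xi + t * D1 N u xi.
Proof. by rewrite /D1; ring. Qed.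

Section FirstVariations.
Context (R : realType) (N : nat) (phi : R -> R) (y u : int -> R).
Context (hphi : potential phi) (D1y_gt0 : forall xi, 0 < D1 N y xi).

Local Notation phi' := (derive1n 1 phi).
Local Notation s := (D1 N y).
Local Notation v := (D1 N u).

Let pair_derive (a b : int) : is_derive (0 : R) 1
  (fun t => phi (D1 N (fun z => y z + t * u z) a + D1 N (fun z => y z + t * u z) b))
  (phi' (s a + s b) * (v a + v b)).
Proof.
apply: is_derive_along_line => //; first by rewrite addr_gt0.
by move=> t; rewrite !D1_line; ring.
Qed.

Let double_derive (a : int) : is_derive (0 : R) 1
  (fun t => phi (2 * D1 N (fun z => y z + t * u z) a))
  (phi' (2 * s a) * (2 * v a)).
Proof.
apply: is_derive_along_line => //; first by rewrite mulr_gt0.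
by move=> t; rewrite !D1_line; ring.
Qed.

Let single_derive (a : int) : is_derive (0 : R) 1
  (fun t => phi (D1 N (fun z => y z + t * u z) a)) (phi' (s a) * v a).
Proof.
apply: is_derive_along_line => //.
by move=> t; rewrite !D1_line; ring.
Qed.

Lemma first_variation_at :
  first_variation (Phi_at N phi) y u =
  eps R N * sum_period N (fun xi =>
    phi' (s xi) * v xi + phi' (s xi + s (xi + 1)) * (v xi + v (xi + 1))).
Proof.
apply: (@first_variation_sum_period _ _ (fun y xi =>
  phi (D1 N y xi) + phi (D1 N y xi + D1 N y (xi + 1)))) => xi.
exact: (is_deriveD (single_derive xi) (pair_derive xi (xi + 1))).
Qed.

Lemma first_variation_qnl (beta : int -> R) :
  first_variation (Phi_qnl N phi beta) y u =
  eps R N * sum_period N (fun xi =>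
    phi' (s xi) * v xi
    + beta xi * (phi' (s xi + s (xi + 1)) * (v xi + v (xi + 1)))
    + (1 - beta xi) * (phi' (2 * s xi) * v xi
                       + phi' (2 * s (xi + 1)) * v (xi + 1))).
Proof.
apply: (@first_variation_sum_period _ _ (fun y xi =>
    phi (D1 N y xi)
    + beta xi * phi (D1 N y xi + D1 N y (xi + 1))
    + (1 - beta xi) / 2 * (phi (2 * D1 N y xi) + phi (2 * D1 N y (xi + 1))))) => xi.
have D := is_deriveD
  (is_deriveD (single_derive xi) (is_deriveZ (beta xi) (pair_derive xi (xi + 1))))
  (is_deriveZ ((1 - beta xi) / 2) (is_deriveD (double_derive xi) (double_derive (xi + 1)))).
by apply: (is_derive_eq D); rewrite /GRing.scale /=; field.
Qed.

Lemma first_variation_qce (gamma : int -> R) :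
  first_variation (Phi_qce N phi gamma) y u =
  eps R N * sum_period N (fun xi =>
    phi' (s xi) * v xi
    + gamma xi * (phi' (2 * s xi) * v xi + phi' (2 * s (xi + 1)) * v (xi + 1))
    + (1 - gamma xi) / 2
      * (phi' (s (xi - 1) + s xi) * (v (xi - 1) + v xi)
         + phi' (s (xi + 1) + s (xi + 2)) * (v (xi + 1) + v (xi + 2)))).
Proof.
apply: (@first_variation_sum_period _ _ (fun y xi =>
    phi (D1 N y xi)
    + gamma xi / 2 * (phi (2 * D1 N y xi) + phi (2 * D1 N y (xi + 1)))
    + (1 - gamma xi) / 2 * (phi (D1 N y (xi - 1) + D1 N y xi)
                            + phi (D1 N y (xi + 1) + D1 N y (xi + 2))))) => xi.
have D := is_deriveD
  (is_deriveD (single_derive xi)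
     (is_deriveZ (gamma xi / 2) (is_deriveD (double_derive xi) (double_derive (xi + 1)))))
  (is_deriveZ ((1 - gamma xi) / 2)
     (is_deriveD (pair_derive (xi - 1) xi) (pair_derive (xi + 1) (xi + 2)))).
by apply: (is_derive_eq D); rewrite /GRing.scale /=; field.
Qed.

End FirstVariations.

(** * Slopes and higher differences *)

(** A positive infimum can only come from a set that is bounded below, because
the infimum of any other set is 0 by convention. *)
Lemma ge_min_lattice (R : realType) (v : int -> R) (xi : int) :
  0 < min_lattice v -> min_lattice v <= v xi.
Proof.
rewrite /min_lattice => m0; apply: ge_inf; last by exists xi.
have [[]//|/inf_out m_eq0] := pselect (has_inf (range v)).
by rewrite m_eq0 ltxx in m0.
Qed.

Lemma periodic_D1_displacement (R : realType) (N : nat) (u : int -> R) :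
  displacements N u -> Defs.periodic N (D1 N u).
Proof. by move=> [uper _] xi; rewrite /D1 (addrAC xi) !uper. Qed.

Lemma periodic_D1_deformation (R : realType) (N : nat) (F : R) (y : int -> R) :
  deformations N F y -> Defs.periodic N (D1 N y).
Proof.
move=> [u [uper _] yE] xi; rewrite /D1 (addrAC xi) !yE !uper !rmorphD /=.
by congr (_ / _); ring.
Qed.

Lemma D2E (R : realType) (N : nat) (hN : (0 < N)%N) (y : int -> R) (xi : int) :
  D2 N y xi = (D1 N y (xi + 1) - D1 N y xi) / eps R N.
Proof.
have e0 : eps R N != 0 by rewrite invr_eq0 pnatr_eq0 -lt0n.
by rewrite /D2 /D1 addrK; field.
Qed.

Lemma D3E (R : realType) (N : nat) (hN : (0 < N)%N) (y : int -> R) (xi : int) :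
  D3 N y xi = (D2 N y xi - D2 N y (xi - 1)) / eps R N.
Proof.
have e0 : eps R N != 0 by rewrite invr_eq0 pnatr_eq0 -lt0n.
rewrite /D3 /D2 subrK (_ : xi - 1 - 1 = xi - 2); first by field.
by ring.
Qed.

(** * The dual norm *)

(** The density S is dominated pointwise by a combination T of several
functions; applying Hoelder's inequality to each of them separately yields the
sum of their norms without Minkowski's inequality. *)
Lemma norm_Um1_le (R : realType) (N : nat) (p : \bar R) (hp : (1 <= p)%E)
    (l : (int -> R) -> R) (S : int -> R) (T : seq (R * (int -> R))) :
  (forall u, displacements N u ->
     l u = eps R N * sum_period N (fun xi => S xi * D1 N u xi)) ->
  all (fun x => 0 <= x.1) T ->
  (forall xi, `|S xi| <= \sum_(x <- T) x.1 * `|x.2 xi|) ->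
  (norm_Um1 N p l <= (\sum_(x <- T) x.1 * lnorm N p x.2)%:E)%E.
Proof.
move=> lE T0 ST; apply: ge_ereal_sup => _ [u [uD u1] <-]; rewrite lee_fin.
have e0 : 0 <= eps R N by rewrite invr_ge0.
rewrite lE// normrM (ger0_norm e0).
apply: (@le_trans _ _ (eps R N *
    sum_period N (fun xi => (\sum_(x <- T) x.1 * `|x.2 xi|) * `|D1 N u xi|))).
  rewrite ler_wpM2l// (le_trans (ler_norm_sum _ _ _))// ler_sum// => k _.
  by rewrite normrM ler_wpM2r.
elim: T T0 {ST} => [|x T IH] /=.
  rewrite !big_nil /sum_period => _.
  by rewrite big1 ?mulr0// => k _; rewrite big_nil mul0r.
move=> /andP[x0 T0]; rewrite big_cons.
rewrite (_ : eps R N * _ = x.1 * (eps R N * sum_period N (fun xi => `|x.2 xi| * `|D1 N u xi|))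
   + eps R N * sum_period N (fun xi => (\sum_(x <- T) x.1 * `|x.2 xi|) * `|D1 N u xi|)); last first.
  rewrite mulrCA -mulrDr; congr (_ * _).
  rewrite /sum_period mulr_sumr -big_split /=.
  by apply: eq_bigr => k _; rewrite big_cons mulrDl mulrA.
rewrite lerD ?IH// ler_wpM2l// (le_trans (lnorm_hoelder _ _ _ hp))//.
by rewrite ler_piMr// lnorm_ge0.
Qed.

(** * The error functional *)

(** With f = phi' and s = y', this is the coefficient of u'_xi in the difference
of the atomistic and the BQNL first variations: each of the two second-neighbour
bonds that contain the bond (xi-1, xi) contributes the error of replacing its
stress by that of a uniformly stretched chain. *)
Definition stress_defect (R : realType) (f : R -> R) (s b : int -> R) (xi : int) : R :=
  (1 - b xi) * (f (s xi + s (xi + 1)) - f (2 * s xi))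
  + (1 - b (xi - 1)) * (f (s (xi - 1) + s xi) - f (2 * s xi)).

(** Rewriting 1 - b xi as (1 - b (xi - 1)) - Delta b xi separates the variation
of the blending function, which meets a first difference of f, from a second
difference of f with the single weight 1 - b (xi - 1). The last term is
therefore attached to the site xi - 1. *)
Lemma stress_defect_bound (R : realType) (N : nat) (hN : (0 < N)%N) (phi : R -> R)
    (y b : int -> R) (xi : int) :
  potential phi -> 0 < min_lattice (D1 N y) ->
  `|stress_defect (derive1n 1 phi) (D1 N y) b xi| <=
    eps R N * Csup phi 2 (2 * min_lattice (D1 N y)) * `|Delta b xi * D2 N y xi|
    + (eps R N ^+ 2 * Csup phi 2 (2 * min_lattice (D1 N y))
         * `|(1 - b (xi - 1)) * D3 N y xi|
       + eps R N ^+ 2 * Csup phi 3 (2 * min_lattice (D1 N y))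
         * `|(1 - b (xi - 1)) * D2 N y (xi - 1) ^+ 2|).
Proof.
move=> hphi m0; set e := eps R N.
set C2 := Csup phi 2 _; set C3 := Csup phi 3 _.
have e0 : 0 < e by rewrite invr_gt0 ltr0n.
have e_neq0 : e != 0 by rewrite gt_eqF.
have r0_gt0 : 0 < 2 * min_lattice (D1 N y) by rewrite mulr_gt0.
have s_ge z : min_lattice (D1 N y) <= D1 N y z by exact: ge_min_lattice.
have dphi k : (k < 4)%N -> forall r, 2 * min_lattice (D1 N y) <= r ->
    is_derive r 1 (derive1n k phi) (derive1n k.+1 phi r).
  by move=> k4 r rm; apply: potential_is_derive => //; exact: lt_le_trans rm.
have bound k : (k < 4)%N -> forall r, 2 * min_lattice (D1 N y) <= r ->
    `|derive1n k phi r| <= Csup phi k (2 * min_lattice (D1 N y)).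
  by move=> k4 r; exact: le_Csup.
have s0 := s_ge xi; have sp := s_ge (xi + 1); have sm := s_ge (xi - 1).
rewrite /stress_defect /Delta D3E// !D2E// subrK -/e.
(* e is made opaque: otherwise norm rewriting sees it as an inverse *)
move: e e0 e_neq0 => e e0 e_neq0.
move: (D1 N y xi) (D1 N y (xi + 1)) (D1 N y (xi - 1)) s0 sp sm => s s1 s_1 s0 sp sm.
pose x := 2 * s; pose a := s1 - s; pose h := s - s_1.
have -> : s + s1 = x + a by rewrite /x /a; ring.
have -> : s_1 + s = x - h by rewrite /x /h; ring.
have -> : 2 * s = x by [].
have rx : 2 * min_lattice (D1 N y) <= x by rewrite /x; lra.
have ra : 2 * min_lattice (D1 N y) <= x + a by rewrite /x /a; lra.
have rh : 2 * min_lattice (D1 N y) <= x - h by rewrite /x /h; lra.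
rewrite -/a -/h; set f := derive1n 1 phi; set d := b xi - b (xi - 1).
set w := 1 - b (xi - 1).
have -> : (1 - b xi) * (f (x + a) - f x) + w * (f (x - h) - f x)
        = - d * (f (x + a) - f x) + w * (f (x + a) + f (x - h) - 2 * f x).
  by rewrite /d /w; ring.
rewrite (le_trans (ler_normD _ _))// lerD//.
  rewrite !normrM normrN normfV (gtr0_norm e0).
  rewrite (_ : e * C2 * (`|d| * (`|a| / e)) = `|d| * (C2 * `|a|)); last by field.
  rewrite ler_wpM2l//.
  have := lipschitz_of_derive_bound (dphi 1 isT) (bound 2 isT) rx ra.
  by rewrite (addrC x) addrK.
have -> : a / e - h / e = (a - h) / e by ring.
rewrite !normrM !normfV (gtr0_norm e0).
have -> : e ^+ 2 * C2 * (`|w| * (`|a - h| / e / e))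
        + e ^+ 2 * C3 * (`|w| * (`|h| / e * (`|h| / e)))
        = `|w| * (C2 * `|a - h| + C3 * h ^+ 2).
  by rewrite -(real_normK (num_real h)); field.
rewrite ler_wpM2l//.
exact: (asymmetric_second_difference_bound (dphi 1 isT) (dphi 2 isT)
          (bound 2 isT) (bound 3 isT)).
Qed.

Section ErrorFunctional.
Context (R : realType) (N : nat) (F : R) (phi : R -> R) (y u : int -> R).
Context (hphi : potential phi) (hy : deformations N F y)
        (hu : displacements N u) (hmin : 0 < min_lattice (D1 N y)).

Local Notation f := (derive1n 1 phi).
Local Notation s := (D1 N y).
Local Notation v := (D1 N u).

Let s_gt0 (xi : int) : 0 < s xi.
Proof. exact: lt_le_trans hmin (ge_min_lattice _ hmin). Qed.

Let sper : Defs.periodic N s. Proof. exact: periodic_D1_deformation hy. Qed.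
Let vper : Defs.periodic N v. Proof. exact: periodic_D1_displacement hu. Qed.

(** The flux through xi + 1 is the part of the density at xi that multiplies
v (xi + 1). *)
Lemma qnl_error_functional (beta : int -> R) : blending N beta ->
  first_variation (Phi_at N phi) y u - first_variation (Phi_qnl N phi beta) y u
  = eps R N * sum_period N (fun xi => stress_defect f s beta xi * v xi).
Proof.
move=> [bper _]; rewrite first_variation_at// first_variation_qnl//.
rewrite -mulrBr -sum_periodB; congr (_ * _).
apply: (@sum_period_telescope _ _ _ _ (fun xi =>
  (1 - beta (xi - 1)) * (f (s (xi - 1) + s xi) - f (2 * s xi)) * v xi)).
  by move=> xi; rewrite (addrAC xi) !(bper, sper, vper).
by move=> xi; rewrite /stress_defect addrK; ring.
Qed.

(** The bond energy of (xi, xi + 1) is sampled by the sites xi - 1 and xi + 1,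
with total weight beta xi. The weights in front of f (2 s xi) do not match those
of the pair bonds: (1 - beta xi) + (1 - beta (xi - 1)) exceeds the continuum
weight 2 alpha xi by Delta2 alpha xi, which is the ghost force. *)
Lemma qce_error_functional (gamma : int -> R) : blending N gamma ->
  let alpha (xi : int) : R := (gamma xi + gamma (xi - 1)) / 2 in
  let beta (xi : int) : R := 1 - (gamma (xi + 1) + gamma (xi - 1)) / 2 in
  first_variation (Phi_at N phi) y u - first_variation (Phi_qce N phi gamma) y u
  = eps R N * sum_period N (fun xi =>
      (Delta2 alpha xi * f (2 * s xi) + stress_defect f s beta xi) * v xi).
Proof.
move=> [gper _] alpha beta; rewrite first_variation_at// first_variation_qce//.
rewrite -mulrBr -sum_periodB; congr (_ * _).
pose W xi := f (s xi + s (xi + 1)) * (v xi + v (xi + 1)).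
have bper : Defs.periodic N beta.
  by move=> xi; rewrite /beta (addrAC xi _ 1) (addrAC xi _ (-1)) !gper.
have Wper : Defs.periodic N W.
  by move=> xi; rewrite /W (addrAC xi) !(sper, vper).
(* In order: the two halves of the blended pair bonds moved to the site xi, the
   continuum bonds at xi + 1, and the v (xi + 1) part of the pair bond xi. *)
apply: (@sum_period_telescope _ _ _ _ (fun xi =>
  (1 - gamma xi) / 2 * W (xi - 1) - (1 - gamma (xi - 1)) / 2 * W xi
  - gamma (xi - 1) * f (2 * s xi) * v xi
  + (1 - beta (xi - 1)) * f (s (xi - 1) + s xi) * v xi)).
  by move=> xi; rewrite (addrAC xi) !(gper, bper, Wper, sper, vper).
move=> xi; rewrite /stress_defect /Delta2 /alpha /beta /W !(addrK, subrK).
have -> : xi + 1 + 1 = xi + 2 by ring.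
by field.
Qed.

End ErrorFunctional.

Theorem theorem3p1 (R : realType) (N : nat) (hN : (0 < N)%N)
    (F : R) (hF : 0 < F) (phi : R -> R) (hphi : potential phi)
    (p : \bar R) (hp : (1 <= p)%E)
    (y : int -> R) (hy : deformations N F y)
    (hmin : 0 < min_lattice (D1 N y)) :
  let e := eps R N in
  let rmin := 2 * min_lattice (D1 N y) in
  let C1 := Csup phi 1 rmin in
  let C2 := Csup phi 2 rmin in
  let C3 := Csup phi 3 rmin in
  (forall gamma : int -> R, blending N gamma ->
    let alpha (xi : int) : R := (gamma xi + gamma (xi - 1)) / 2 in
    let beta (xi : int) : R := 1 - (gamma (xi + 1) + gamma (xi - 1)) / 2 in
    (norm_Um1 N p (fun u => (first_variation (Phi_at N phi) y u
                             - first_variation (Phi_qce N phi gamma) y u)%R)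
     <= (C1 * lnorm N p (Delta2 alpha)
         + e * C2 * lnorm N p (fun xi => Delta beta xi * D2 N y xi)
         + e ^+ 2 *
           (C2 * lnorm N p (fun xi => (1 - beta (xi - 1)) * D3 N y xi)
            + C3 * lnorm N p (fun xi => (1 - beta xi) * D2 N y xi ^+ 2)))%R%:E)%E)
  /\
  (forall beta : int -> R, blending N beta ->
    (norm_Um1 N p (fun u => (first_variation (Phi_at N phi) y u
                             - first_variation (Phi_qnl N phi beta) y u)%R)
     <= (e * C2 * lnorm N p (fun xi => Delta beta xi * D2 N y xi)
         + e ^+ 2 *
           (C2 * lnorm N p (fun xi => (1 - beta (xi - 1)) * D3 N y xi)
            + C3 * lnorm N p (fun xi => (1 - beta xi) * D2 N y xi ^+ 2)))%R%:E)%E).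
Proof.
move=> e rmin C1 C2 C3.
have e0 : 0 <= e by rewrite invr_ge0.
have rmin_gt0 : 0 < rmin by rewrite mulr_gt0.
have C_bound k r : (k < 4)%N -> rmin <= r -> `|derive1n k phi r| <= Csup phi k rmin.
  by move=> k4; exact: le_Csup.
have C_ge0 k : (k < 4)%N -> 0 <= Csup phi k rmin.
  by move=> k4; apply: le_trans (C_bound k rmin k4 _).
have C1_ge0 : 0 <= C1 by exact: C_ge0.
have C2_ge0 : 0 <= C2 by exact: C_ge0.
have C3_ge0 : 0 <= C3 by exact: C_ge0.
have C1_bound xi : `|derive1n 1 phi (2 * D1 N y xi)| <= C1.
  by apply: C_bound; rewrite // ler_pM2l// ge_min_lattice.
have defect_bound beta xi := stress_defect_bound hN beta xi hphi hmin.
rewrite -/e -/rmin -/C2 -/C3 in defect_bound.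
(* The constants are abstract from here on. *)
move: e C1 C2 C3 e0 C1_ge0 C2_ge0 C3_ge0 C1_bound defect_bound.
move=> e C1 C2 C3 e0 C1_ge0 C2_ge0 C3_ge0 C1_bound defect_bound.
have D2_shift beta : Defs.periodic N beta ->
    C3 * lnorm N p (fun xi => (1 - beta (xi - 1)) * D2 N y (xi - 1) ^+ 2)
    <= C3 * lnorm N p (fun xi => (1 - beta xi) * D2 N y xi ^+ 2).
  move=> bper; rewrite ler_wpM2l//.
  apply: (@lnorm_shift _ N hN p (fun xi => (1 - beta xi) * D2 N y xi ^+ 2)) => xi.
  have sper := periodic_D1_deformation hy.
  by rewrite !D2E// (addrAC xi) !(bper, sper).
pose pieces beta : seq (R * (int -> R)) :=
  [:: (e * C2, fun xi => Delta beta xi * D2 N y xi);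
      (e ^+ 2 * C2, fun xi => (1 - beta (xi - 1)) * D3 N y xi);
      (e ^+ 2 * C3, fun xi => (1 - beta (xi - 1)) * D2 N y (xi - 1) ^+ 2)].
have pieces_ge0 beta : all (fun x => 0 <= x.1) (pieces beta).
  apply/and4P; split=> //; first exact: (mulr_ge0 e0 C2_ge0).
    exact: (mulr_ge0 (exprn_ge0 2 e0) C2_ge0).
  exact: (mulr_ge0 (exprn_ge0 2 e0) C3_ge0).
have pieces_bound beta xi :
    `|stress_defect (derive1n 1 phi) (D1 N y) beta xi|
      <= \sum_(x <- pieces beta) x.1 * `|x.2 xi|.
  by rewrite !big_cons big_nil addr0; exact: defect_bound.
have pieces_sum beta : Defs.periodic N beta ->
    \sum_(x <- pieces beta) x.1 * lnorm N p x.2 <=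
    e * C2 * lnorm N p (fun xi => Delta beta xi * D2 N y xi)
    + e ^+ 2 *
      (C2 * lnorm N p (fun xi => (1 - beta (xi - 1)) * D3 N y xi)
       + C3 * lnorm N p (fun xi => (1 - beta xi) * D2 N y xi ^+ 2)).
  move=> bper; rewrite !big_cons big_nil addr0 /= -!(mulrA (e ^+ 2)) -mulrDr.
  by rewrite lerD2l ler_wpM2l ?exprn_ge0// lerD2l D2_shift.
split=> [gamma hgamma|beta hbeta].
- (* the local definitions sit under the coercion of booleans to propositions *)
  lazy zeta; set alpha := fun xi => (gamma xi + _) / 2.
  set beta := fun xi => 1 - _.
  have [gper _] := hgamma.
  have bper : Defs.periodic N beta.
    by move=> xi; rewrite /beta (addrAC xi _ 1) (addrAC xi _ (-1)) !gper.
  have lE u (hu : displacements N u) := qce_error_functional hphi hy hu hmin hgamma.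
  apply: le_trans (norm_Um1_le hp (T := (C1, Delta2 alpha) :: pieces beta) lE _ _) _.
  + by apply/andP; split; [exact: C1_ge0|exact: pieces_ge0].
  + move=> xi; rewrite big_cons (le_trans (ler_normD _ _))// lerD//.
    by rewrite normrM mulrC ler_wpM2r.
  + by rewrite lee_fin big_cons -addrA lerD2l pieces_sum.
- have lE u (hu : displacements N u) := qnl_error_functional hphi hy hu hmin hbeta.
  apply: le_trans (norm_Um1_le hp lE (pieces_ge0 beta) (pieces_bound beta)) _.
  by rewrite lee_fin pieces_sum//; case: hbeta.
Qed.
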